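(* Let $X$ be a Banach space, $Y$ an ordered Banach space with closed positive cone, and $S: D(S)\subset X\to Y$ a closed linear operator. Let $(A,D(A))$ be the generator of a strongly continuous semigroup $(e^{tA})_{t\ge 0}$ on $X$ and, for each $n\in\mathbb{N}$, let $(A_n,D(A_n))$ be the generator of a strongly continuous $S$-shape preserving semigroup $(e^{tA_n})_{t\ge 0}$ on $X$. Assume that there are constants $M\ge 1$ and $\omega\in\mathbb{R}$ such that $\|e^{tA}\|\le Me^{\omega t}$ and $\|e^{tA_n}\|\le M e^{\omega t}$ for all $t\ge 0$ and all $n$, and that for some $\lambda$ with $\operatorname{Re}\lambda>\omega$, $$(\lambda-A)^{-1}x=\lim_{n\to\infty}(\lambda-A_n)^{-1}x\qquad\text{for all }x\in X.$$ Suppose that $A$ is compatible with $S$, i.e., $C_A=C$. Then $(e^{tA})_{t\ge 0}$ is $S$-shape preserving.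
   Context: For a closed operator $S:D(S)\subset X\to Y$ put $C:=\overline{\{x\in D(S): Sx\ge 0\}}$, and for a generator $(A,D(A))$ of a strongly continuous semigroup on $X$ put $C_A:=\overline{\{x\in D(A)\cap D(S): Sx\ge 0\}}$ (closures in $X$). The semigroup $(e^{tA})_{t\ge0}$ is called $S$-shape preserving if (a) $C=C_A$ and (b) $e^{tA}C\subset C$ for all $t\ge 0$. *)

(* Defs.v *)
From HB Require Import structures.
From mathcomp Require Import all_boot all_order all_algebra.
From mathcomp Require Import all_classical all_reals all_analysis.
From mathcomp Require Import complex.

Set Implicit Arguments.
Unset Strict Implicit.
Unset Printing Implicit Defensive.

Import Order.TTheory GRing.Theory Num.Theory.
Import numFieldNormedType.Exports.

Local Open Scope classical_set_scope.
Local Open Scope ring_scope.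

(* Banach spaces are taken over either the real or the complex numbers. *)
Variant scalar_kind := RealScalars | ComplexScalars.

Definition scalars (R : realType) (k : scalar_kind) : numFieldType :=
  match k with
  | RealScalars => R
  | ComplexScalars => R[i]%C
  end.

Definition of_real (R : realType) (k : scalar_kind) : R -> scalars R k :=
  match k return R -> scalars R k with
  | RealScalars => fun r => r
  | ComplexScalars => fun r => (r%:C)%C
  end.

Definition re (R : realType) (k : scalar_kind) : scalars R k -> R :=
  match k return scalars R k -> R with
  | RealScalars => fun z => z
  | ComplexScalars => fun z => complex.Re z
  end.

Arguments of_real {R} k r.
Arguments re {R k} z.

(* Over a complex space only multiplication by nonnegative reals has to respect
   the order; in a numFieldType, [0 <= a] already says that a is such a real. *)
Record vector_order (K : numFieldType) (Y : lmodType K)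
    (le : Y -> Y -> Prop) : Prop := VectorOrder {
  vector_order_refl : forall y, le y y;
  vector_order_anti : forall y z, le y z -> le z y -> y = z;
  vector_order_trans : forall y z w, le y z -> le z w -> le y w;
  vector_order_add : forall y z w, le y z -> le (y + w) (z + w);
  vector_order_scale : forall (a : K) y z, 0 <= a -> le y z -> le (a *: y) (a *: z)
}.

Definition positive_cone (K : numFieldType) (Y : lmodType K)
    (le : Y -> Y -> Prop) : set Y := [set y | le 0 y].

(* A partially defined linear map; the values of [op] outside [dom] are junk. *)
Record linear_operator (K : numFieldType) (X Y : lmodType K) := LinearOperator {
  dom : set X;
  op :> X -> Y;
  dom0 : dom 0;
  dom_linear : forall (a : K) x y, dom x -> dom y -> dom (a *: x + y);
  op_linear : forall (a : K) x y, dom x -> dom y ->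
    op (a *: x + y) = a *: op x + op y
}.

Definition closed_operator (K : numFieldType) (X Y : normedModType K)
    (S : linear_operator X Y) : Prop :=
  closed [set p : X * Y | dom S p.1 /\ S p.1 = p.2].

Record strongly_continuous_semigroup (R : realType) (k : scalar_kind)
    (X : normedModType (scalars R k)) (T : R -> X -> X) : Prop :=
    StronglyContinuousSemigroup {
  semigroup_linear : forall t, 0 <= t -> linear (T t);
  semigroup_bounded : forall t, 0 <= t -> continuous (T t);
  semigroup0 : forall x, T 0 x = x;
  semigroupD : forall s t x, 0 <= s -> 0 <= t -> T (s + t) x = T s (T t x);
  semigroup_orbit : forall x,
    {within `[0, +oo[, continuous (fun t => T t x)}
}.

Definition is_generator (R : realType) (k : scalar_kind)
    (X : normedModType (scalars R k)) (T : R -> X -> X)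
    (A : linear_operator X X) : Prop :=
  let quotient x (h : R) := of_real k h^-1 *: (T h x - x) in
  (forall x, dom A x <-> cvg (quotient x h @[h --> 0^'+])) /\
  (forall x, dom A x -> quotient x h @[h --> 0^'+] --> A x).

(* [operator_norm_le F c] is the bound ||F|| <= c. *)
Definition operator_norm_le (R : realType) (k : scalar_kind)
    (X : normedModType (scalars R k)) (F : X -> X) (c : R) : Prop :=
  forall x, `|F x| <= of_real k c * `|x|.

(* (lam - A)^-1 x; it is the junk value 0 when lam - A does not reach x. *)
Definition resolvent (K : numFieldType) (X : lmodType K)
    (A : linear_operator X X) (lam : K) (x : X) : X :=
  xget 0 [set y | dom A y /\ lam *: y - A y = x].

Section ShapePreserving.
Variables (R : realType) (k : scalar_kind).
Variables (X Y : normedModType (scalars R k)).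
Variables (le : Y -> Y -> Prop) (S : linear_operator X Y).

Definition shape_cone : set X :=
  closure [set x | dom S x /\ positive_cone le (S x)].

Definition generator_shape_cone (A : linear_operator X X) : set X :=
  closure [set x | (dom A `&` dom S) x /\ positive_cone le (S x)].

Definition compatible (A : linear_operator X X) : Prop :=
  generator_shape_cone A = shape_cone.

(* T is the semigroup generated by A. *)
Definition shape_preserving (A : linear_operator X X) (T : R -> X -> X) : Prop :=
  shape_cone = generator_shape_cone A /\
  forall t, 0 <= t -> T t @` shape_cone `<=` shape_cone.

End ShapePreserving.

(* Main.v *)
(* The theorem follows from the Trotter-Kato theorem: T_n(t) x -> T(t) x for all x
   and t >= 0, and the closed cone C, being invariant under every T_n(t), is then
   invariant under T(t).
   After rescaling by exp(-lam t) one may take lam = 0 and all semigroups U, U_n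
   to decay exponentially, with F = -B^-1 and F_n = -B_n^-1 for their generators.
   The curve s |-> U_n(t - s) F_n U(s) F x joins U_n(t) F_n F x to F_n U(t) F x, and
   its derivative U_n(t - s) (F - F_n) U(s) x tends to 0 uniformly on [0, t],
   because {U(s) x} is compact; hence F_n (U(t) - U_n(t)) -> 0 on the dense range of
   F, so everywhere. Together with F_n -> F this yields U_n(t) F x -> U(t) F x.
   No vector-valued integral is needed: derivatives are controlled by a mean value
   inequality, and the solution of -B y = x, usually the Laplace integral of U x, is
   obtained as tau times the limit of the averages of U over dyadic subdivisions of
   [0, tau], applied to the solution of v - U(tau) v = x. *)

From HB Require Import structures.
Require Import Defs.
From mathcomp Require Import all_boot all_order all_algebra.
From mathcomp Require Import all_classical all_reals all_analysis.
From mathcomp Require Import complex.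
From mathcomp Require Import ring lra.

Set Implicit Arguments.
Unset Strict Implicit.
Unset Printing Implicit Defensive.

Import Order.TTheory GRing.Theory Num.Theory.
Import numFieldNormedType.Exports.

Local Open Scope classical_set_scope.
Local Open Scope ring_scope.

(** * Restriction of scalars *)

Section Scalars.
Variables (R : realType) (k : scalar_kind).
Implicit Types (r s : R) (z : scalars R k).

Lemma of_realB : {morph @of_real R k : r s / r - s}.
Proof. by case: k => //= r s; exact: (rmorphB (real_complex R)). Qed.

Lemma of_realM : {morph @of_real R k : r s / r * s}.
Proof. by case: k => //= r s; exact: (rmorphM (real_complex R)). Qed.

Lemma of_real1 : of_real k 1 = 1 :> scalars R k.
Proof. by case: k. Qed.

HB.instance Definition _ := GRing.isZmodMorphism.Build _ _ (@of_real R k) of_realB.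
HB.instance Definition _ :=
  GRing.isMonoidMorphism.Build _ _ (@of_real R k) (conj of_real1 of_realM).

Lemma ler_of_real r s : (of_real k r <= of_real k s) = (r <= s).
Proof. by case: k => //=; rewrite lecR. Qed.

Lemma ltr_of_real r s : (of_real k r < of_real k s) = (r < s).
Proof. by case: k => //=; rewrite ltcR. Qed.

Lemma of_realK : cancel (@of_real R k) re.
Proof. by case: k. Qed.

Lemma normr_of_real r : `|of_real k r| = of_real k `|r|.
Proof.
case: k => //=; rewrite normc_def /= expr0n addr0 sqrtr_sqr //.
Qed.

Lemma reK z : 0 <= z -> of_real k (re z) = z.
Proof.
case: k z => [//|[a b]]; rewrite lecE /= => /andP[/eqP b0 _].
by rewrite b0.
Qed.

End Scalars.

(* [realify X] has the very uniform structure of [X], so that convergence in [X]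
   and in [realify X] are convertible statements. *)
Definition realify (R : realType) (k : scalar_kind)
  (X : completeNormedModType (scalars R k)) : Type := X.

Section Realify.
Variables (R : realType) (k : scalar_kind).
Variable X : completeNormedModType (scalars R k).

HB.instance Definition _ := Uniform.on (realify X).
HB.instance Definition _ := Complete.on (realify X).
HB.instance Definition _ := GRing.Zmodule.on (realify X).

Definition realify_scale (r : R) (x : realify X) : realify X :=
  of_real k r *: (x : X).

Lemma realify_scaleA r s x :
  realify_scale r (realify_scale s x) = realify_scale (r * s) x.
Proof. by rewrite /realify_scale scalerA rmorphM. Qed.

Lemma realify_scale1 : left_id 1 realify_scale.
Proof. by move=> x; rewrite /realify_scale rmorph1 scale1r. Qed.

Lemma realify_scaleDr : right_distributive realify_scale +%R.
Proof. by move=> r x y; rewrite /realify_scale scalerDr. Qed.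

Lemma realify_scaleDl x : {morph realify_scale^~ x : r s / r + s}.
Proof. by move=> r s; rewrite /realify_scale rmorphD scalerDl. Qed.

HB.instance Definition _ := GRing.Zmodule_isLmodule.Build R (realify X)
  realify_scaleA realify_scale1 realify_scaleDr realify_scaleDl.

Definition realify_norm (x : realify X) : R := re `|x : X|.

Lemma of_real_realify_norm x : of_real k (realify_norm x) = `|x : X|.
Proof. exact: reK. Qed.

Lemma realify_normD x y :
  realify_norm (x + y) <= realify_norm x + realify_norm y.
Proof.
rewrite -(ler_of_real k) rmorphD /= !of_real_realify_norm; exact: (@ler_normD _ X).
Qed.

Lemma realify_normZ (r : R) x : realify_norm (r *: x) = `|r| * realify_norm x.
Proof.
apply: (can_inj (@of_realK R k)).
rewrite rmorphM /= !of_real_realify_norm -normr_of_real; exact: (@normrZ _ X).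
Qed.

Lemma realify_norm0_eq0 x : realify_norm x = 0 -> x = 0.
Proof.
by move=> /(congr1 (of_real k)); rewrite of_real_realify_norm rmorph0 => /normr0_eq0.
Qed.

Lemma realify_normMn x n : realify_norm (x *+ n) = realify_norm x *+ n.
Proof. by rewrite -scaler_nat realify_normZ ger0_norm// mulr_natl. Qed.

Lemma realify_normN x : realify_norm (- x) = realify_norm x.
Proof. by rewrite -scaleN1r realify_normZ normrN1 mul1r. Qed.

HB.instance Definition _ := Num.Zmodule_isNormed.Build R (realify X)
  realify_normD realify_norm0_eq0 realify_normMn realify_normN.

Definition realify_ball : realify X -> R -> realify X -> Prop :=
  ball_ (fun x : realify X => `|x|).

Lemma realify_ballE (x : X) r : realify_ball x r = ball x (of_real k r).
Proof.
apply/seteqP; split => y; rewrite -ball_normE /realify_ball /ball_ /=.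
  by rewrite -(ltr_of_real k) of_real_realify_norm.
by rewrite -[X in X < _ -> _]of_real_realify_norm ltr_of_real.
Qed.

Lemma realify_ball_center x (e : R) : 0 < e -> realify_ball x e x.
Proof.
rewrite -(ltr_of_real k) rmorph0 realify_ballE; exact: (@ballxx _ X).
Qed.

Lemma realify_ball_sym x y (e : R) : realify_ball x e y -> realify_ball y e x.
Proof. by rewrite !realify_ballE; exact: (@ball_sym _ X). Qed.

Lemma realify_ball_triangle x y z (e1 e2 : R) :
  realify_ball x e1 y -> realify_ball y e2 z -> realify_ball x (e1 + e2) z.
Proof. by rewrite !realify_ballE rmorphD; exact: (@ball_triangle _ X). Qed.

(** Radii of balls in [X] are positive elements of [scalars R k], hence real by [reK], so both kinds
    of ball generate the same uniformity. *)
Lemma realify_entourageE :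
  @entourage (realify X) = entourage_ realify_ball.
Proof.
rewrite -[LHS](@entourage_ballE _ X); apply/seteqP; split => A [e /= e0 eA].
  have ere : of_real k (re e) = e by rewrite reK// ltW.
  exists (re e) => [|xy]; first by rewrite /= -(ltr_of_real k) ere rmorph0.
  by rewrite /= realify_ballE ere => /eA.
exists (of_real k e) => [|xy]; first by rewrite /= -(rmorph0 (of_real k)) ltr_of_real.
by rewrite /= -realify_ballE => /eA.
Qed.

HB.instance Definition _ := Uniform_isPseudoMetric.Build R (realify X)
  realify_ball_center realify_ball_sym realify_ball_triangle realify_entourageE.

HB.instance Definition _ :=
  NormedZmod_PseudoMetric_eq.Build R (realify X) erefl.

HB.instance Definition _ :=
  PseudoMetricNormedZmod_Lmodule_isNormedModule.Build R (realify X) realify_normZ.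

End Realify.

(** * Exponentially decaying semigroups *)

Lemma half_pow_small (R : realType) (c e : R) : 0 < c -> 0 < e ->
  \forall m \near \oo, c / 2 ^+ m <= e.
Proof.
move=> c0 e0; near=> m.
rewrite -ler_pdivlMl// mulrC -[(2 ^+ m)^-1]mul1r ltW//.
by near: m; exact: (near_infty_natSinv_expn_lt (PosNum (divr_gt0 e0 c0))).
Unshelve. all: by end_near. Qed.

Lemma cauchy_seq_cvg (R : realType) (V : completeNormedModType R) (u : nat -> V) :
  (forall e, 0 < e -> exists m, forall n, `|u (m + n)%N - u m| <= e) ->
  cvg (u @ \oo).
Proof.
move=> H; apply/cauchy_cvgP/cauchy_exP => e e0.
have e2 : 0 < e / 2 by rewrite divr_gt0.
have [m um] := H _ e2; exists (u m); exists m => //= n /= mn.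
rewrite -ball_normE /ball_/= distrC -(subnKC mn).
by apply: le_lt_trans (um _) _; lra.
Qed.

(** Only right-hand increments are controlled, so a supremum argument is used: the estimate from [a]
    with slope [c + e] passes, by continuity, to the supremum of the points where it holds, and it
    would extend further if that supremum were below [b]. *)
Lemma mean_value_le (R : realType) (V : normedModType R) (g : R -> V) (c a b : R) :
  0 <= c -> a <= b -> {within `[a, b], continuous g} ->
  (forall s e, a <= s < b -> 0 < e ->
     \forall h \near 0^'+, `|g (s + h) - g s| <= (c + e) * h) ->
  `|g b - g a| <= c * (b - a).
Proof.
move=> c0 ab /subspace_continuousP gc gd.
suff le_e e : 0 < e -> `|g b - g a| <= (c + e) * (b - a).
  apply/ler_addgt0Pr => e e0.
  (* The summand 1 keeps the denominator positive when [a = b]. *)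
  have b1 : 0 < b - a + 1 by lra.
  apply: le_trans (le_e (e / (b - a + 1)) _) _; first exact: divr_gt0.
  rewrite mulrDl lerD2l mulrAC ler_pdivrMr// ler_pM2l//; lra.
move=> e0.
pose A := [set s | a <= s <= b /\ `|g s - g a| <= (c + e) * (s - a)].
have Aa : A a by split; rewrite ?lexx ?ab// !subrr normr0 mulr0.
have supA : has_sup A.
  by split; [exists a | exists b => s [/andP[]]].
have sA s : A s -> s <= sup A by move=> As; exact: (ub_le_sup supA.2).
have asA := sA _ Aa.
have sAb : sup A <= b by apply: ge_sup; [exact: supA.1 | move=> s [/andP[]]].
have AsA : A (sup A).
  split; first by rewrite asA sAb.
  apply/ler_addgt0Pr => d d0.
  have := gc (sup A); rewrite /= in_itv/= asA sAb => /(_ isT)/cvgrPdist_le/(_ d d0).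
  rewrite near_withinE => /nbhs_ballP[/= r r0 rg].
  have [s As rs] := sup_adherent r0 supA.
  have ss := sA _ As.
  have {rg} : `|g (sup A) - g s| <= d.
    apply: rg; first by rewrite /ball/= ger0_norm; lra.
    by case: As => + _; rewrite /= in_itv.
  case: As => _ sga gs.
  have ls : (c + e) * (s - a) <= (c + e) * (sup A - a).
    by apply: ler_wpM2l; lra.
  rewrite -(subrKA (g s)); apply: le_trans (ler_normD _ _) _; lra.
have [sb|bs] := ltP (sup A) b; last first.
  by have -> : b = sup A by [apply/eqP; rewrite eq_le bs sAb]; case: AsA.
have /filter_ex : \forall h \near 0^'+, 0 < h /\ h < b - sup A /\ 
    `|g (sup A + h) - g (sup A)| <= (c + e) * h.
  near=> h; split; first by near: h; exact: nbhs_right_gt.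
  split; first by near: h; apply: nbhs_right_lt; lra.
  by near: h; apply: gd; rewrite ?asA.
move=> -[h [h0 [hb gh]]].
have /sA : A (sup A + h); last lra.
split; first lra.
case: AsA => _ gs.
rewrite -(subrKA (g (sup A))); apply: le_trans (ler_normD _ _) _.
have -> : (c + e) * (sup A + h - a) = (c + e) * h + (c + e) * (sup A - a) by ring.
exact: lerD.
Unshelve. all: by end_near. Qed.

Section DecayingSemigroup.
Variables (R : realType) (V : completeNormedModType R).

(* Halving the norm at the single time [tau] is all that is needed of the
   exponential decay. *)
Record decaying_semigroup (M tau : R) (U : R -> V -> V) : Prop := {
  decaying_linear : forall t, 0 <= t -> linear (U t);
  decaying0 : forall x, U 0 x = x;
  decayingD : forall s t x, 0 <= s -> 0 <= t -> U (s + t) x = U s (U t x);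
  decaying_bound : forall t x, 0 <= t -> `|U t x| <= M * `|x|;
  decaying_half : forall x, `|U tau x| <= 2^-1 * `|x|;
  decaying_orbit : forall x, {within `[0, +oo[, continuous (U^~ x)}
}.

(** A relation rather than an operator, so that neither a domain nor values outside it have to be
    chosen. *)
Definition generator_graph (U : R -> V -> V) (y z : V) : Prop :=
  h^-1 *: (U h y - y) @[h --> 0^'+] --> z.

(* [F] is minus the inverse of the generator, i.e. its resolvent at 0. *)
Definition is_inverse_generator (U : R -> V -> V) (F : V -> V) : Prop :=
  forall x, generator_graph U (F x) (- x).

(** The division-free form [U h y = y + h *: z + o(h)], suited to the increments in
    [mean_value_le]. *)
Lemma generator_graphP U y z : generator_graph U y z <->
  forall e, 0 < e -> \forall h \near 0^'+, `|U h y - y - h *: z| <= e * h.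
Proof.
have E h : 0 < h -> `|z - h^-1 *: (U h y - y)| = h^-1 * `|U h y - y - h *: z|.
  move=> h0; rewrite -[z in LHS](scalerK (lt0r_neq0 h0)) -scalerBr normrZ.
  by rewrite gtr0_norm ?invr_gt0// distrC.
split => [/cvgrPdist_le H e e0|H].
  near=> h.
  have h0 : 0 < h by near: h; exact: nbhs_right_gt.
  rewrite -ler_pdivrMr// mulrC -E//.
  by near: h; exact: H.
apply/cvgrPdist_le => e e0; near=> h.
have h0 : 0 < h by near: h; exact: nbhs_right_gt.
rewrite E// mulrC ler_pdivrMr//.
by near: h; exact: H.
Unshelve. all: by end_near. Qed.

(** * Calculus of a decaying semigroup and its generator *)

Section Theory.
Variables (M tau : R) (U : R -> V -> V).
Hypotheses (M0 : 0 < M) (tau0 : 0 < tau) (hU : decaying_semigroup M tau U).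

Lemma decayingDr t x y : 0 <= t -> U t (x + y) = U t x + U t y.
Proof. by move=> t0; have := decaying_linear hU t0 1 x y; rewrite !scale1r. Qed.

Lemma decaying00 t : 0 <= t -> U t 0 = 0.
Proof.
by move=> t0; apply: (addIr (U t 0)); rewrite -decayingDr// !add0r.
Qed.

Lemma decayingZ t a x : 0 <= t -> U t (a *: x) = a *: U t x.
Proof.
move=> t0; have := decaying_linear hU t0 a x 0.
by rewrite decaying00// !addr0.
Qed.

Lemma decayingB t x y : 0 <= t -> U t (x - y) = U t x - U t y.
Proof. by move=> t0; rewrite decayingDr// -scaleN1r decayingZ// scaleN1r. Qed.

Lemma decaying_continuous t : 0 <= t -> continuous (U t).
Proof.
move=> t0 x; apply/cvgrPdist_le => e e0; near=> y.
rewrite -decayingB//; apply: le_trans (decaying_bound hU _ t0) _.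
rewrite -ler_pdivlMl// mulrC.
near: y; apply: cvgr_dist_le; first exact: cvg_id.
exact: divr_gt0.
Unshelve. all: by end_near. Qed.

Lemma decaying_orbit_dist x t e : 0 <= t -> 0 < e ->
  exists2 d, 0 < d & forall s, 0 <= s -> `|t - s| < d -> `|U t x - U s x| <= e.
Proof.
move=> t0 e0; have /subspace_continuousP/(_ t) := @decaying_orbit _ _ _ hU x.
rewrite /= in_itv/= andbT => /(_ t0)/cvgrPdist_le/(_ e e0).
rewrite near_withinE => /nbhs_ballP[/= d d0 H].
by exists d => // s s0 st; apply: H => //=; rewrite in_itv/= s0.
Qed.

Lemma generator_graphD y z y' z' : generator_graph U y z ->
  generator_graph U y' z' -> generator_graph U (y + y') (z + z').
Proof.
move=> yz yz'; rewrite /generator_graph.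
have : h^-1 *: (U h y - y) + h^-1 *: (U h y' - y') @[h --> 0^'+] --> z + z'.
  exact: cvgD.
apply: cvg_trans; apply: near_eq_cvg; near=> h.
have h0 : 0 <= h by near: h; exact: nbhs_right_ge.
by rewrite decayingDr// -scalerDr opprD addrACA.
Unshelve. all: by end_near. Qed.

Lemma generator_graphZ a y z : generator_graph U y z ->
  generator_graph U (a *: y) (a *: z).
Proof.
move=> yz; rewrite /generator_graph.
have : a *: (h^-1 *: (U h y - y)) @[h --> 0^'+] --> a *: z.
  by apply: cvgZ => //; exact: cvg_cst.
apply: cvg_trans; apply: near_eq_cvg; near=> h.
have h0 : 0 <= h by near: h; exact: nbhs_right_ge.
by rewrite decayingZ// -(scalerBr a) !scalerA mulrC.
Unshelve. all: by end_near. Qed.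

Lemma generator_graphU s y z : 0 <= s -> generator_graph U y z ->
  generator_graph U (U s y) (U s z).
Proof.
move=> s0 yz; rewrite /generator_graph.
have : U s (h^-1 *: (U h y - y)) @[h --> 0^'+] --> U s z.
  by apply: continuous_cvg => //; exact: decaying_continuous.
apply: cvg_trans; apply: near_eq_cvg; near=> h.
have h0 : 0 <= h by near: h; exact: nbhs_right_ge.
have <- : U s (U h y) = U h (U s y).
  by rewrite -!(decayingD hU)// addrC.
by rewrite decayingZ// decayingB.
Unshelve. all: by end_near. Qed.

(** By the mean value inequality along the orbit, [U tau y - y] has norm at most [M * tau] times
    that of [z]; halving at [tau] makes it at least half the norm of [y]. Hence the generator is
    injective with bounded inverse. *)
Lemma generator_graph_bound y z : generator_graph U y z ->
  `|y| <= 2 * tau * M * `|z|.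
Proof.
move=> /generator_graphP yz.
have : `|U tau y - U 0 y| <= M * `|z| * (tau - 0).
  apply: (mean_value_le (g := U^~ y)) => //; first 2 last.
  - apply: continuous_subspaceW (@decaying_orbit _ _ _ hU y).
    by move=> s /=; rewrite !in_itv/= => /andP[->].
  - move=> s e /andP[s0 _] e0; near=> h.
    have h0 : 0 < h by near: h; exact: nbhs_right_gt.
    have h_ge0 := ltW h0.
    rewrite (decayingD hU)//.
    rewrite -decayingB//.
    apply: le_trans (decaying_bound hU _ s0) _.
    (* The remainder is allowed only [e / M], because the outer [U s] costs a factor [M]. *)
    have -> : (M * `|z| + e) * h = M * (h * `|z| + e / M * h).
      by field; exact: lt0r_neq0.
    rewrite ler_pM2l// -(subrK (h *: z) (U h y - y)).
    apply: le_trans (ler_normD _ _) _; rewrite addrC normrZ gtr0_norm// lerD2l.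
    by near: h; apply: yz; exact: divr_gt0.
  - by rewrite mulr_ge0// ltW.
  - exact: ltW.
rewrite (decaying0 hU) subr0 => le1.
have := decaying_half hU y.
have := lerB_dist y (U tau y); rewrite distrC => le2 le3.
have -> : 2 * tau * M * `|z| = 2 * (M * `|z| * tau) by ring.
lra.
Unshelve. all: by end_near. Qed.

Lemma generator_graph_inj y y' z : generator_graph U y z ->
  generator_graph U y' z -> y = y'.
Proof.
move=> yz /(@generator_graphZ (-1) _ _) yz'.
have := generator_graph_bound (generator_graphD yz yz').
by rewrite !scaleN1r subrr normr0 mulr0 normr_le0 subr_eq0 => /eqP.
Qed.

(** * Linearity, boundedness and dense range of the inverse generator *)

Section Inverse.
Variable F : V -> V.
Hypothesis hF : is_inverse_generator U F.

(** [F] is known only through the graph; linearity, and below the commutation with [U t], hold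
    because the injective generator sends both sides to the same vector. *)
Lemma inverse_generatorB x y : F (x - y) = F x - F y.
Proof.
apply: (generator_graph_inj (@hF _)).
have := generator_graphD (@hF x) (@generator_graphZ (-1) _ _ (@hF y)).
by rewrite !scaleN1r opprB opprK (addrC (- x)).
Qed.

Lemma inverse_generatorZ a x : F (a *: x) = a *: F x.
Proof.
apply: (generator_graph_inj (@hF _)).
by have := @generator_graphZ a _ _ (@hF x); rewrite scalerN.
Qed.

Lemma inverse_generatorU t x : 0 <= t -> U t (F x) = F (U t x).
Proof.
move=> t0; apply: generator_graph_inj _ (@hF _).
have := generator_graphU t0 (@hF x).
by rewrite -scaleN1r decayingZ// scaleN1r.
Qed.

Lemma inverse_generator_bound x : `|F x| <= 2 * tau * M * `|x|.
Proof. by have := generator_graph_bound (@hF x); rewrite normrN. Qed.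

(** The quotients [h^-1 *: (F x - U h (F x))] tend to [x], and they lie in the range of [F] because
    [F] is linear and commutes with [U h]. *)
Lemma inverse_generator_dense x e : 0 < e -> exists w, `|x - F w| <= e.
Proof.
move=> e0; have /generator_graphP/(_ e e0) H := @hF x.
have /filter_ex[h [h0 H']] : \forall h \near 0^'+, 0 < h /\
    `|U h (F x) - F x - h *: (- x)| <= e * h.
  near=> h; split; first by near: h; exact: nbhs_right_gt.
  by near: h.
have h_ge0 := ltW h0.
exists (h^-1 *: (x - U h x)).
rewrite inverse_generatorZ inverse_generatorB -inverse_generatorU//.
rewrite -[x in x - _](scalerK (lt0r_neq0 h0)) -scalerBr normrZ gtr0_norm ?invr_gt0//.
rewrite ler_pdivrMl// mulrC; apply: le_trans H'.
by rewrite scalerN opprK opprB (addrC (h *: x)).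
Unshelve. all: by end_near. Qed.

End Inverse.

(** Strong continuity handles the change of time at the fixed vector [v]; the uniform bound [M]
    absorbs the change from [v_ i] to [v]. *)
Lemma decaying_cvg (T : Type) (F : set_system T) {FF : Filter F}
    (s_ : T -> R) (v_ : T -> V) (s : R) v :
  (\forall i \near F, 0 <= s_ i) -> 0 <= s ->
  s_ @ F --> s -> v_ @ F --> v -> U (s_ i) (v_ i) @[i --> F] --> U s v.
Proof.
move=> si0 s0 ss vv; apply/cvgrPdist_le => e e0.
have e20 : 0 < e / 2 by rewrite divr_gt0.
have [d d0 H] := decaying_orbit_dist v s0 e20.
near=> i.
have i0 : 0 <= s_ i by near: i.
rewrite -(subrKA (U (s_ i) v)) -decayingB//.
apply: le_trans (ler_normD _ _) _; rewrite [leRHS]splitr; apply: lerD.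
  apply: H => //; near: i.
  by move/cvgrPdist_lt: ss; exact.
apply: le_trans (decaying_bound hU _ i0) _.
rewrite -ler_pdivlMl//; near: i.
move/cvgrPdist_le: vv; apply.
by rewrite mulr_gt0// invr_gt0.
Unshelve. all: by end_near. Qed.

(** * Surjectivity of the generator by dyadic averages *)

Lemma decaying_subr_surjective x : exists v, v - U tau v = x.
Proof.
have tau_ge0 := ltW tau0.
(* Partial sums of the Neumann series for [1 - U tau], where [U tau] has norm at most one half. *)
pose u n := iter n (fun v => x + U tau v) 0.
have uS n : u n.+1 = x + U tau (u n) by [].
have u_le n : `|u n| <= 2 * `|x|.
  elim: n => [|n IH]; first by rewrite normr0 mulr_ge0.
  rewrite uS; apply: le_trans (ler_normD _ _) _.
  have := decaying_half hU (u n); lra.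
have u_dist m n : `|u (m + n)%N - u m| <= 2 * `|x| / 2 ^+ m.
  elim: m => [|m IH]; first by rewrite expr0 divr1 subr0.
  rewrite addSn !uS [x + _]addrC addrKA -decayingB//.
  apply: le_trans (decaying_half hU _) _.
  by rewrite exprS invfM mulrCA ler_pM2l.
have /cvg_ex[v uv] : cvg (u @ \oo).
  apply: cauchy_seq_cvg => e e0.
  (* The summand 1 covers [x = 0]. *)
  have x1 : 0 < 2 * `|x| + 1 by have := normr_ge0 x; lra.
  have /filter_ex[m le_e] := half_pow_small x1 e0.
  exists m => n; apply: le_trans (u_dist m n) (le_trans _ le_e).
  by rewrite ler_pM2r ?invr_gt0 ?exprn_gt0//; lra.
exists v; apply/eqP; rewrite subr_eq; apply/eqP.
have uSv : [sequence u n.+1]_n @ \oo --> v by rewrite cvg_shiftS.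
apply: (cvg_unique (@norm_hausdorff _ V) uSv).
apply: cvgD; first exact: cvg_cst.
by apply: continuous_cvg => //; exact: decaying_continuous.
Qed.

(* The average of [U (i * h / 2 ^ n) v] over [i < 2 ^ n]: a Riemann sum. *)
Fixpoint orbit_average (h : R) (n : nat) (v : V) : V :=
  if n is n'.+1 then
    2^-1 *: (orbit_average (h / 2) n' v + orbit_average (h / 2) n' (U (h / 2) v))
  else v.

Lemma orbit_averageB h n v w : 0 <= h ->
  orbit_average h n (v - w) = orbit_average h n v - orbit_average h n w.
Proof.
elim: n h v w => //= n IH h v w h0.
have h20 : 0 <= h / 2 by rewrite divr_ge0.
by rewrite decayingB// !IH// -scalerBr opprD addrACA.
Qed.

Lemma orbit_averageU h n s v : 0 <= h -> 0 <= s ->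
  orbit_average h n (U s v) = U s (orbit_average h n v).
Proof.
elim: n h v => //= n IH h v h0 s0.
have h20 : 0 <= h / 2 by rewrite divr_ge0.
have <- : U s (U (h / 2) v) = U (h / 2) (U s v).
  by rewrite -!(decayingD hU)// addrC.
by rewrite decayingZ// decayingDr// !IH.
Qed.

(** Shifting the Riemann sum by its mesh [h / 2 ^+ n] moves every node to the next one, so only the
    two end terms survive. *)
Lemma orbit_average_telescope h n v : 0 <= h ->
  orbit_average h n v - U (h / 2 ^+ n) (orbit_average h n v) =
  (2 ^+ n)^-1 *: (v - U h v).
Proof.
elim: n h v => [|n IH] h v h0; first by rewrite expr0 divr1 invr1 scale1r.
have h20 : 0 <= h / 2 by rewrite divr_ge0.
have hn0 : 0 <= h / 2 / 2 ^+ n by rewrite divr_ge0// exprn_ge0.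
rewrite /= exprS invfM mulrA decayingZ// -scalerBr decayingDr// opprD addrACA.
rewrite !IH// -scalerDr scalerA subrKA -(decayingD hU)//.
by rewrite -splitr mulrC.
Qed.

Lemma orbit_average_dist h n v w e : 0 <= h ->
  (forall s, 0 <= s <= h -> `|U s v - w| <= e) ->
  `|orbit_average h n v - w| <= e.
Proof.
elim: n h v => [|n IH] h v h0 H /=.
  by have := H 0; rewrite lexx h0 (decaying0 hU) => /(_ isT).
have h20 : 0 <= h / 2 by rewrite divr_ge0.
have half2 : 2^-1 + 2^-1 = 1 :> R by field.
have -> : w = 2^-1 *: (w + w) by rewrite scalerDr -scalerDl half2 scale1r.
rewrite -scalerBr opprD addrACA normrZ ger0_norm//.
rewrite ler_pdivrMl//; apply: le_trans (ler_normD _ _) _.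
have -> : 2 * e = e + e by ring.
apply: lerD; apply: IH => // s /andP[s0 sh].
  by apply: H; rewrite s0/=; lra.
by rewrite -(decayingD hU)//; apply: H; apply/andP; split; lra.
Qed.

(** The nodes of the fine grid are grouped by coarse cells; since averages commute with the
    semigroup, averaging within a cell can be done first, on the initial cell. *)
Lemma orbit_average_add h m n v : 0 <= h ->
  orbit_average h (m + n) v =
  orbit_average h m (orbit_average (h / 2 ^+ m) n v).
Proof.
elim: m h v => [|m IH] h v h0; first by rewrite expr0 divr1.
have h20 : 0 <= h / 2 by rewrite divr_ge0.
have hm0 : 0 <= h / 2 / 2 ^+ m by rewrite divr_ge0// exprn_ge0.
by rewrite addSn /= !IH// exprS invfM mulrA -orbit_averageU.
Qed.

(** The averages are Cauchy: refining beyond level [m] replaces [v] by its average over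
    [[0, h / 2 ^+ m]], which is close to [v] by strong continuity at 0; the outer average costs a
    factor [M]. *)
Lemma orbit_average_cvg h v : 0 <= h ->
  cvg (orbit_average h n v @[n --> \oo]).
Proof.
move=> h0; apply: cauchy_seq_cvg => e e0.
have eM0 : 0 < e / M by rewrite divr_gt0.
have [d d0 H] := decaying_orbit_dist v (lexx 0) eM0.
(* [h + 1] is positive even for [h = 0], and [d / 2] leaves room for the strict inequality that [H]
   demands. *)
have h1 : 0 < h + 1 by lra.
have d2 : 0 < d / 2 by rewrite divr_gt0.
have /filter_ex[m hm] := half_pow_small h1 d2.
have lt_hm : h / 2 ^+ m <= (h + 1) / 2 ^+ m.
  by rewrite ler_pM2r ?invr_gt0 ?exprn_gt0//; lra.
have hm0 : 0 <= h / 2 ^+ m by rewrite divr_ge0// exprn_ge0.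
exists m => n; rewrite orbit_average_add// -orbit_averageB//.
rewrite -[X in `|X|]subr0; apply: orbit_average_dist => // s /andP[s0 _].
rewrite subr0; apply: le_trans (decaying_bound hU _ s0) _.
rewrite -ler_pdivlMl// [leRHS]mulrC; apply: orbit_average_dist => // r /andP[r0 rh].
rewrite -[v in _ - v](decaying0 hU) distrC; apply: H => //.
by rewrite sub0r normrN ger0_norm//; lra.
Qed.

(** Telescoping writes [U (q%:R * h) v - v] as [- c] times the sum of the vectors [U (i * h) x] over
    [i < q], each of which is within [e] of [x]. *)
Lemma decaying_iter_dist h c v x e (q : nat) : 0 <= h -> 0 <= c ->
  v - U h v = c *: x ->
  (forall r, 0 <= r <= q%:R * h -> `|U r x - x| <= e) ->
  `|U (q%:R * h) v - v + (q%:R * c) *: x| <= q%:R * c * e.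
Proof.
move=> h0 c0 vx; elim: q => [|q IH] H.
  by rewrite !mul0r (decaying0 hU) subrr scale0r addr0 normr0.
have qh0 : 0 <= q%:R * h by rewrite mulr_ge0.
have HE : q.+1%:R * h = q%:R * h + h by rewrite -natr1; ring.
have Uh : U h v = v - c *: x by rewrite -vx subKr.
have -> : U (q.+1%:R * h) v - v + (q.+1%:R * c) *: x =
    (U (q%:R * h) v - v + (q%:R * c) *: x) - c *: (U (q%:R * h) x - x).
  rewrite HE (decayingD hU)// Uh decayingB// decayingZ//.
  rewrite -natr1 mulrDl mul1r scalerDl scalerBr opprB.
  rewrite [X in X + _ = _]addrAC addrACA; congr (_ + _); exact: addrC.
rewrite -[q.+1%:R]natr1 !mulrDl mul1r.
apply: le_trans (ler_normB _ _) _; apply: lerD.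
  by apply: IH => r /andP[r0 rq]; apply: H; rewrite r0/= HE; lra.
rewrite normrZ ger0_norm// ler_wpM2l//; apply: H; rewrite qh0/= HE; lra.
Qed.

(** With [x' - U tau x' = x], the mean [z] of the orbit of [x'] over [[0, tau]] is sent by the
    generator to [- (tau^-1 *: x)], as in the fundamental theorem of calculus; this is checked on
    the Riemann sums. *)
Lemma inverse_generator_exists x : exists y, generator_graph U y (- x).
Proof.
have [x' x'x] := decaying_subr_surjective x.
have tau_ge0 := ltW tau0.
have /cvg_ex[z zn] := @orbit_average_cvg tau x' tau_ge0.
suff : generator_graph U z (- (tau^-1 *: x)).
  move=> /(@generator_graphZ tau _ _); rewrite scalerN scalerA divff ?gt_eqF// scale1r.
  by move=> ?; exists (tau *: z).
apply/generator_graphP => e e0.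
(* The factor [tau] compensates the weight, about [h / tau], with which this tolerance enters
   below. *)
have et0 : 0 < e * tau by rewrite mulr_gt0.
have [d d0 H] := decaying_orbit_dist x (lexx 0) et0.
near=> h.
have h0 : 0 < h by near: h; exact: nbhs_right_gt.
have hd : h < d by near: h; exact: nbhs_right_lt.
rewrite scalerN opprK scalerA.
pose t m := tau / 2 ^+ m.
have t0 m : 0 < t m by rewrite divr_gt0// exprn_gt0.
(* The number of whole mesh cells of length [t m] in [[0, h]]; rounding [h] down to them loses less
   than [t m], which vanishes in the limit. *)
pose q m := Num.truncn (h / t m).
have qh m : (q m)%:R * t m <= h < (q m)%:R * t m + t m.
  have := @truncn_itv _ (h / t m) (divr_ge0 (ltW h0) (ltW (t0 m))).
  by rewrite ler_pdivlMr// ltr_pdivrMr// -natr1 mulrDl mul1r.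
have qh0 m : 0 <= (q m)%:R * t m by rewrite mulr_ge0// ltW.
have qcvg : (q m)%:R * t m @[m --> \oo] --> h.
  apply/cvgrPdist_le => r r0; near=> m.
  have rt : t m <= r by near: m; exact: half_pow_small.
  have /andP[? ?] := qh m; rewrite ger0_norm; lra.
(* The discrete counterpart of the vector to be bounded; it converges to that vector, so a bound
   uniform in [m] passes to the limit. *)
pose w m := U ((q m)%:R * t m) (orbit_average tau m x') - orbit_average tau m x'
             + ((q m)%:R * t m / tau) *: x.
have wcvg : w m @[m --> \oo] --> U h z - z + (h / tau) *: x.
  apply: cvgD; last by apply: cvgZ; [apply: cvgM => //|]; exact: cvg_cst.
  apply: cvgB => //; apply: decaying_cvg => //; exact: nearW.
apply: (cvgr_to_le (cvg_norm wcvg)); apply: nearW => m.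
have qE : (q m)%:R * t m / tau = (q m)%:R / 2 ^+ m.
  by rewrite /t; field; rewrite !gt_eqF// exprn_gt0.
have tm_ge0 : 0 <= (2 ^+ m)^-1 :> R by rewrite invr_ge0 exprn_ge0.
have := @decaying_iter_dist (t m) (2 ^+ m)^-1 (orbit_average tau m x') x (e * tau)
   (q m) (ltW (t0 m)) tm_ge0.
rewrite orbit_average_telescope// x'x -qE => /(_ erefl) le1.
have {le1} : `|w m| <= (q m)%:R * t m / tau * (e * tau).
  apply: le1 => r /andP[r0 rq]; rewrite -[x in _ - x](decaying0 hU) distrC.
  apply: H => //; rewrite sub0r normrN ger0_norm//.
  have /andP[? ?] := qh m; lra.
move=> /le_trans; apply.
have -> : (q m)%:R * t m / tau * (e * tau) = e * ((q m)%:R * t m).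
  by field; rewrite gt_eqF.
by rewrite ler_pM2l//; case/andP: (qh m).
Unshelve. all: by end_near. Qed.

End Theory.

(** * The Trotter-Kato theorem *)

(** The common Lipschitz constant lets smallness at a point persist near it for the same large [n];
    compactness, in its near-covering form, then makes the choice of [n] uniform. *)
Lemma lipschitz_cvg0_compact (D : nat -> V -> V) (L : R) (K : set V) (e : R) :
  0 < L -> compact K -> (forall n x y, `|D n x - D n y| <= L * `|x - y|) ->
  (forall x, D n x @[n --> \oo] --> 0) -> 0 < e ->
  \forall n \near \oo, forall x, K x -> `|D n x| <= e.
Proof.
move=> L0 cK lipD D0 e0.
apply: (iffLR (compact_near_coveringP K) cK nat \oo (fun n x => `|D n x| <= e)).
move=> x _.
have e20 : 0 < e / 2 by rewrite divr_gt0.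
near=> x' n.
rewrite -(subrK (D n x) (D n x')); apply: le_trans (ler_normD _ _) _.
rewrite [leRHS]splitr; apply: lerD.
  apply: le_trans (lipD _ _ _) _; rewrite -ler_pdivlMl// distrC.
  near: x'; apply: cvgr_dist_le; first exact: cvg_id.
  by rewrite mulr_gt0// invr_gt0.
rewrite -normrN -sub0r.
near: n; move/cvgrPdist_le: (D0 x); exact.
Unshelve. all: by end_near. Qed.

(* Telescopes along [s |-> U1 (t - s) (F1 (U2 s (F2 x)))], whose derivative is
   [U1 (t - s) ((F2 - F1) (U2 s x))]. *)
Lemma inverse_generator_difference (M tau : R) U1 U2 (F1 F2 : V -> V) t c x :
  0 < M -> 0 < tau ->
  decaying_semigroup M tau U1 -> decaying_semigroup M tau U2 ->
  is_inverse_generator U1 F1 -> is_inverse_generator U2 F2 ->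
  0 <= t -> 0 <= c ->
  (forall s, 0 <= s <= t -> `|F2 (U2 s x) - F1 (U2 s x)| <= c) ->
  `|F1 (U2 t (F2 x)) - F1 (U1 t (F2 x))| <= M * c * t.
Proof.
move=> M0 tau0 hU1 hU2 hF1 hF2 t0 c0 Hc.
pose K := 2 * tau * M.
have K0 : 0 < K by rewrite !mulr_gt0.
have F1_bound w : `|F1 w| <= K * `|w| := inverse_generator_bound M0 tau0 hU1 hF1 w.
have F1B := inverse_generatorB M0 tau0 hU1 hF1.
have F1Z := inverse_generatorZ M0 tau0 hU1 hF1.
have F1_cont : continuous F1.
  move=> w; apply/cvgrPdist_le => e e0; near=> w'.
  rewrite -F1B; apply: le_trans (F1_bound _) _.
  rewrite -ler_pdivlMl//; near: w'; apply: cvgr_dist_le; first exact: cvg_id.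
  by rewrite mulr_gt0// invr_gt0.
pose g s := U1 (t - s) (F1 (U2 s (F2 x))).
have gt : g t = F1 (U2 t (F2 x)) by rewrite /g subrr (decaying0 hU1).
have g0 : g 0 = F1 (U1 t (F2 x)).
  by rewrite /g subr0 (decaying0 hU2) (inverse_generatorU M0 tau0 hU1 hF1).
rewrite -gt -g0 -[t in M * c * t]subr0; apply: mean_value_le => //.
- by rewrite mulr_ge0// ltW.
- apply/subspace_continuousP => s; rewrite /= in_itv/= => /andP[s0 st].
  have cvs : (fun r => r) @ within `[0, t] (nbhs s) --> s.
    exact: cvg_within.
  apply: (decaying_cvg M0 hU1).
  + apply: filterS (withinT _ _) => // r.
    by rewrite /= in_itv/= subr_ge0 => /andP[].
  + by rewrite subr_ge0.
  + by apply: cvgB => //; exact: cvg_cst.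
  + apply: continuous_cvg; first exact: F1_cont.
    apply: (decaying_cvg M0 hU2) => //; last exact: cvg_cst.
    apply: filterS (withinT _ _) => // r.
    by rewrite /= in_itv/= => /andP[].
- move=> s e /andP[s0 st] e0.
  (* Chosen so that [M * (K * d + d) = e]: one remainder passes through [F1], at cost [K], and the
     other does not. *)
  pose d := e / (M * (K + 1)).
  have d0 : 0 < d by rewrite divr_gt0// mulr_gt0// addr_gt0.
  pose w := U2 s x.
  have /generator_graphP/(_ d d0) H2 := @hF2 w.
  have /generator_graphP/(_ d d0) H1 := @hF1 (F2 w).
  near=> h.
  have h0 : 0 < h by near: h; exact: nbhs_right_gt.
  have h_ge0 := ltW h0.
  have hts : 0 <= t - (s + h).
    by rewrite subr_ge0 -lerBrDl; near: h; apply: nbhs_right_le; rewrite subr_gt0.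
  have U2E : U2 s (F2 x) = F2 w by rewrite (inverse_generatorU M0 tau0 hU2 hF2).
  have gE : g (s + h) - g s =
      U1 (t - (s + h)) (F1 (U2 h (F2 w)) - U1 h (F1 (F2 w))).
    have U2sh : U2 (s + h) (F2 x) = U2 h (F2 w).
      by rewrite addrC (decayingD hU2)// U2E.
    have tsh : t - s = t - (s + h) + h by ring.
    by rewrite /g U2sh U2E tsh (decayingD hU1 _ hts h_ge0) (decayingB hU1).
  rewrite gE; apply: le_trans (decaying_bound hU1 _ hts) _.
  set a := U2 h (F2 w) - F2 w - h *: - w.
  set b := U1 h (F1 (F2 w)) - F1 (F2 w) - h *: - F2 w.
  (* The first-order parts combine to [h *: (F2 w - F1 w)]; [a] and [b] are the remainders of order
     [o(h)] for the two generators. *)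
  have -> : F1 (U2 h (F2 w)) - U1 h (F1 (F2 w)) = F1 a - b + h *: (F2 w - F1 w).
    have -> : F1 a = F1 (U2 h (F2 w)) - F1 (F2 w) + h *: F1 w.
      by rewrite /a !F1B scalerN -scaleNr F1Z scaleNr opprK.
    rewrite /b scalerN opprK scalerBr opprD [X in _ = X + _]addrACA
      -[RHS]addrA subrKA subrr addr0.
    by rewrite opprB subrKA.
  have a_le : `|a| <= d * h by rewrite /a; near: h; exact: H2.
  have b_le : `|b| <= d * h by rewrite /b; near: h; exact: H1.
  have -> : (M * c + e) * h = M * (K * (d * h) + d * h + h * c).
    rewrite /d; field; rewrite gt_eqF ?addr_gt0//= gt_eqF//.
  rewrite ler_pM2l//; apply: le_trans (ler_normD _ _) _; apply: lerD.
    apply: le_trans (ler_normB _ _) _; apply: lerD => //.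
    by apply: le_trans (F1_bound _) _; rewrite ler_pM2l.
  rewrite normrZ gtr0_norm// ler_pM2l//; apply: Hc; rewrite s0 ltW//.
Unshelve. all: by end_near. Qed.

(** The common Lipschitz constant makes the error of replacing [x] by a nearby [F w] uniform in
    [n]. *)
Lemma cvg0_on_dense (G : nat -> V -> V) (F : V -> V) (L : R) : 0 < L ->
  (forall n x y, `|G n x - G n y| <= L * `|x - y|) ->
  (forall x e, 0 < e -> exists w, `|x - F w| <= e) ->
  (forall x, G n (F x) @[n --> \oo] --> 0) ->
  forall x, G n x @[n --> \oo] --> 0.
Proof.
move=> L0 lipG dF GF x; apply/cvgrPdist_le => e e0.
have eL0 : 0 < L^-1 * (e / 2) by rewrite mulr_gt0 ?invr_gt0// divr_gt0.
have e20 : 0 < e / 2 by rewrite divr_gt0.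
have [w xw] := dF x _ eL0.
near=> n.
rewrite sub0r normrN -(subrK (G n (F w)) (G n x)).
apply: le_trans (ler_normD _ _) _; rewrite [leRHS]splitr; apply: lerD.
  by apply: le_trans (lipG _ _ _) _; rewrite -ler_pdivlMl.
rewrite -normrN -sub0r; near: n; move/cvgrPdist_le: (GF w); exact.
Unshelve. all: by end_near. Qed.

Theorem Trotter_Kato (M tau : R) (U : R -> V -> V) (Un : nat -> R -> V -> V)
    (F : V -> V) (Fn : nat -> V -> V) t x :
  0 < M -> 0 < tau ->
  decaying_semigroup M tau U -> (forall n, decaying_semigroup M tau (Un n)) ->
  is_inverse_generator U F -> (forall n, is_inverse_generator (Un n) (Fn n)) ->
  (forall y, Fn n y @[n --> \oo] --> F y) ->
  0 <= t -> Un n t x @[n --> \oo] --> U t x.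
Proof.
move=> M0 tau0 hU hUn hF hFn cvgF t0.
pose K := 2 * tau * M.
have K0 : 0 < K by rewrite !mulr_gt0.
have dF := inverse_generator_dense M0 tau0 hU hF.
have Fn_bound n w : `|Fn n w| <= K * `|w|.
  exact: (inverse_generator_bound M0 tau0 (hUn n) (@hFn n)).
have F_bound w : `|F w| <= K * `|w|.
  exact: (inverse_generator_bound M0 tau0 hU hF).
have FnB n := inverse_generatorB M0 tau0 (hUn n) (@hFn n).
have FB := inverse_generatorB M0 tau0 hU hF.
have lipU n y z : `|(U t y - Un n t y) - (U t z - Un n t z)| <= 2 * M * `|y - z|.
  rewrite opprD addrACA -!opprD -(decayingB hU)// -(decayingB (hUn n))//.
  apply: le_trans (ler_normB _ _) _.
  have := decaying_bound hU (y - z) t0.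
  have := decaying_bound (hUn n) (y - z) t0.
  lra.
(* The orbit of [y] over [[0, t]] is compact, so [F - Fn n] is uniformly small on it and the bound
   of [inverse_generator_difference] tends to 0. *)
have stepA y : Fn n (U t (F y) - Un n t (F y)) @[n --> \oo] --> 0.
  have cK : compact (U^~ y @` `[0, t]).
    apply: continuous_compact; last exact: segment_compact.
    apply: continuous_subspaceW (@decaying_orbit _ _ _ hU y).
    by move=> s /=; rewrite !in_itv/= => /andP[->].
  have D0 w : F w - Fn n w @[n --> \oo] --> 0.
    by rewrite -[X in _ --> X](subrr (F w)); apply: cvgB => //; exact: cvg_cst.
  have lipD n w z : `|(F w - Fn n w) - (F z - Fn n z)| <= 2 * K * `|w - z|.
    rewrite opprD addrACA -!opprD -FB -FnB.
    apply: le_trans (ler_normB _ _) _.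
    have := F_bound (w - z); have := Fn_bound n (w - z); lra.
  apply/cvgrPdist_le => e e0.
  (* [t + 1] in place of [t] allows [t = 0]. *)
  have e1 : 0 < e / (M * (t + 1)).
    by rewrite divr_gt0// mulr_gt0//; lra.
  have K20 : 0 < 2 * K by rewrite mulr_gt0.
  have := @lipschitz_cvg0_compact (fun n w => F w - Fn n w) _ _ _ K20 cK lipD D0 e1.
  apply: filterS => n Hn.
  rewrite sub0r normrN FnB.
  apply: le_trans (inverse_generator_difference M0 tau0 (hUn n) hU (@hFn n) hF t0
    (ltW e1) _) _.
    by move=> s st; apply: Hn; exists s => //=; rewrite in_itv.
  have -> : M * (e / (M * (t + 1))) * t = e * (t / (t + 1)).
    by field; rewrite !gt_eqF//; lra.
  have t1 : t / (t + 1) <= 1 by rewrite ler_pdivrMr; lra.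
  exact: ler_piMr (ltW e0) t1.
have stepB y : Fn n (U t y - Un n t y) @[n --> \oo] --> 0.
  apply: (@cvg0_on_dense (fun n y => Fn n (U t y - Un n t y)) F (K * (2 * M))) => //.
    by rewrite !mulr_gt0.
  move=> n y' z; rewrite -FnB; apply: le_trans (Fn_bound _ _) _.
  by rewrite -mulrA ler_pM2l.
have stepC y : U t (F y) - Un n t (F y) @[n --> \oo] --> 0.
  have Fdiff w : Fn n w - F w @[n --> \oo] --> 0.
    by rewrite -[X in _ --> X](subrr (F w)); apply: cvgB => //; exact: cvg_cst.
  have c1 : Un n t (Fn n y - F y) @[n --> \oo] --> 0.
    apply/cvgrPdist_le => e e0.
    have eM : 0 < M^-1 * e by rewrite mulr_gt0// invr_gt0.
    move/cvgrPdist_le: (Fdiff y) => /(_ _ eM); apply: filterS => n.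
    rewrite !sub0r !normrN => le_e.
    apply: le_trans (decaying_bound (hUn n) _ t0) _.
    by rewrite -ler_pdivlMl.
  (* As [Un n t] commutes with [Fn n], and [U t] with [F], the difference splits into three terms
     that tend to 0: the resolvent error at [y] under the bounded [Un n t], the term of [stepB], and
     the resolvent error at [U t y]. *)
  have -> : (fun n => U t (F y) - Un n t (F y)) = (fun n =>
      Un n t (Fn n y - F y) + Fn n (U t y - Un n t y) - (Fn n (U t y) - F (U t y))).
    apply/funext => n; rewrite (decayingB (hUn n))// FnB.
    rewrite (inverse_generatorU M0 tau0 (hUn n) (@hFn n))//.
    rewrite -(inverse_generatorU M0 tau0 hU hF)//.
    by rewrite [X in _ = X - _]addrC subrKA opprB [RHS]addrC subrKA.
  by have := cvgB (cvgD c1 (stepB y)) (Fdiff (U t y)); rewrite subr0 addr0; exact.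
(* Density of the range of [F] is used again, now for [U t - Un n t] with Lipschitz constant
   [2 * M]. *)
have stepD : U t x - Un n t x @[n --> \oo] --> 0.
  apply: (@cvg0_on_dense (fun n y => U t y - Un n t y) F (2 * M)) => //.
  by rewrite mulr_gt0.
have -> : (fun n => Un n t x) = (fun n => U t x - (U t x - Un n t x)).
  by apply/funext => n; rewrite subKr.
by have := cvgB (cvg_cst (U t x)) stepD; rewrite subr0; exact.
Qed.

End DecayingSemigroup.

(** * Rescaling by the exponential *)

(** The exponential of [mu * t], given in the complex case by Euler's formula. *)
Definition scalar_exp (R : realType) (k : scalar_kind) :
    scalars R k -> R -> scalars R k :=
  match k return scalars R k -> R -> scalars R k with
  | RealScalars => fun mu t => expR (mu * t)
  | ComplexScalars => fun mu t =>
      (expR (complex.Re mu * t) * cos (complex.Im mu * t) +i*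
       (expR (complex.Re mu * t) * sin (complex.Im mu * t)))%C
  end.

Lemma ler_normc_add (R : realType) (a b : R) :
  (`|(a +i* b)%C| <= (`|a| + `|b|)%:C%C).
Proof.
rewrite normc_def lecR /=.
have -> : `|a| + `|b| = Num.sqrt ((`|a| + `|b|) ^+ 2).
  by rewrite sqrtr_sqr [RHS]ger0_norm// addr_ge0.
rewrite ler_sqrt ?sqr_ge0//.
rewrite sqrrD !real_normK ?num_real// lerD2r lerDl.
by rewrite mulrn_wge0// mulr_ge0.
Qed.

Lemma cvg_complex (R : realType) (T : Type) (F : set_system T) {FF : Filter F}
    (f g : T -> R) (a b : R) : f @ F --> a -> g @ F --> b ->
  ((f x +i* g x)%C : scalars R ComplexScalars) @[x --> F] -->
    ((a +i* b)%C : scalars R ComplexScalars).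
Proof.
move=> fa gb; apply/cvgrPdist_le => e e0.
have [r re] : exists r, e = r%:C%C.
  by case: e e0 => x y; rewrite ltcE /= => /andP[/eqP -> _]; exists x.
rewrite re ltcR in e0.
have r20 : 0 < r / 2 by rewrite divr_gt0.
near=> x.
apply: le_trans (ler_normc_add (a - f x) (b - g x)) _.
rewrite re lecR [leRHS]splitr; apply: lerD; near: x.
  by move/cvgrPdist_le: fa; exact.
by move/cvgrPdist_le: gb; exact.
Unshelve. all: by end_near. Qed.

Section ScalarExp.
Variables (R : realType) (k : scalar_kind).
Implicit Types (mu : scalars R k) (s t : R).

Lemma reN mu : re (- mu) = - re mu.
Proof. by case: k mu => [|[]]. Qed.

Lemma scalar_exp0 mu : scalar_exp mu 0 = 1.
Proof.
case: k mu => [mu|[a b]]; rewrite /= !mulr0 ?expR0 //.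
by rewrite cos0 sin0 mulr1 mulr0.
Qed.

Lemma scalar_expD mu s t :
  scalar_exp mu (s + t) = scalar_exp mu s * scalar_exp mu t.
Proof.
case: k mu => [mu|[a b]]; rewrite /= !mulrDr expRD//.
rewrite cosD sinD; apply/eqP; rewrite eq_complex /=; apply/andP; split; apply/eqP; ring.
Qed.

Lemma scalar_expN mu t : scalar_exp (- mu) t = scalar_exp mu (- t).
Proof. by case: k mu => [mu|[a b]]; rewrite /= !mulrN !mulNr. Qed.

Lemma scalar_expVK mu t : scalar_exp mu t * scalar_exp (- mu) t = 1.
Proof. by rewrite scalar_expN -scalar_expD subrr scalar_exp0. Qed.

Lemma normr_scalar_exp mu t : `|scalar_exp mu t| = of_real k (expR (re mu * t)).
Proof.
case: k mu => [mu|[a b]] /=; first by rewrite gtr0_norm// expR_gt0.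
rewrite normc_def /= !exprMn -mulrDr cos2Dsin2 mulr1 sqrtr_sqr gtr0_norm//.
exact: expR_gt0.
Qed.

Lemma continuous_scalar_exp mu : continuous (scalar_exp mu).
Proof.
have mulc (a x : R) : a * y @[y --> x] --> a * x.
  by apply: cvgM => //; exact: cvg_cst.
have expc (a x : R) : expR (a * y) @[y --> x] --> expR (a * x).
  by apply: continuous_cvg; [exact: continuous_expR|exact: mulc].
case: k mu => [mu|[a b]] t; first exact: expc.
have cosc (c x : R) : cos (c * y) @[y --> x] --> cos (c * x).
  by apply: continuous_cvg; [exact: continuous_cos|exact: mulc].
have sinc (c x : R) : sin (c * y) @[y --> x] --> sin (c * x).
  by apply: continuous_cvg; [exact: continuous_sin|exact: mulc].
exact: (cvg_complex (cvgM (expc a t) (cosc b t)) (cvgM (expc a t) (sinc b t))).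
Qed.

Lemma derive_cvg_right (f : R -> R) (l : R) : is_derive (0 : R) (1 : R) f l ->
  h^-1 * (f h - f 0) @[h --> 0^'+] --> l.
Proof.
move=> [df <-]; apply: cvg_dnbhs_at_right.
have : h^-1 *: (f (h *: (1 : R) + 0) - f 0) @[h --> 0^'] --> 'D_(1 : R) f (0 : R).
  exact: df.
apply: cvg_trans; apply: near_eq_cvg; apply: nearW => h.
by rewrite [h *: (1 : R)]mulr1 addr0.
Qed.

(** In the complex case the components are differentiated separately: at 0, [exp (a t) cos (b t)]
    and [exp (a t) sin (b t)] have derivatives [a] and [b]. *)
Lemma scalar_exp_right_derivative mu :
  of_real k h^-1 * (scalar_exp mu h - 1) @[h --> 0^'+] --> mu.
Proof.
have mulD (a : R) : is_derive (0 : R) (1 : R) ( *%R a) a.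
  by rewrite -[X in is_derive _ _ _ X]mulr1; exact: (@is_deriveZ _ _ _ id a).
have compD (f : R -> R) (a l : R) : is_derive (a * 0) (1 : R) f l ->
    is_derive (0 : R) (1 : R) (f \o *%R a) (l * a).
  by move=> fD; exact: is_derive1_comp.
have expD (a : R) := compD _ a _ (is_derive_expR _).
case: k mu => [mu|[a b]].
  have := derive_cvg_right (expD mu).
  by rewrite /= mulr0 expR0 mul1r.
have cosD0 := compD _ b _ (is_derive_cos _).
have sinD0 := compD _ b _ (is_derive_sin _).
have reD : is_derive (0 : R) (1 : R) ((expR \o *%R a) * (cos \o *%R b)) a.
  apply: is_derive_eq; rewrite /= !mulr0 expR0 cos0 sin0 /GRing.scale /=; ring.
have imD : is_derive (0 : R) (1 : R) ((expR \o *%R a) * (sin \o *%R b)) b.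
  apply: is_derive_eq; rewrite /= !mulr0 expR0 cos0 sin0 /GRing.scale /=; ring.
set f := (expR \o *%R a) * (cos \o *%R b) in reD.
set g := (expR \o *%R a) * (sin \o *%R b) in imD.
suff -> : (fun h => of_real ComplexScalars h^-1 *
    (@scalar_exp R ComplexScalars (a +i* b)%C h - 1)) =
    (fun h => (h^-1 * (f h - f 0) +i* (h^-1 * (g h - g 0)))%C).
  exact: cvg_complex (derive_cvg_right reD) (derive_cvg_right imD).
apply/funext => h /=; rewrite /f /g !fctE /= !mulr0 expR0 cos0 sin0.
by apply/eqP; rewrite eq_complex /=; apply/andP; split; apply/eqP; ring.
Qed.

End ScalarExp.

(** * Rescaled semigroups and their resolvents *)

Section Rescaling.
Variables (R : realType) (k : scalar_kind).
Variable X : completeNormedModType (scalars R k).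
Implicit Types (T : R -> X -> X) (lam : scalars R k).

(* The semigroup generated by [A - lam] when [T] is generated by [A]. *)
Definition rescaled_semigroup T lam (t : R) (x : realify X) : realify X :=
  scalar_exp (- lam) t *: T t x.

(** At this time the rescaled bound is [M * exp (- 2 M)], at most [M / (1 + 2 M)] and so at most one
    half. It depends only on [M], [omega] and [lam], and therefore serves all the semigroups at
    once. *)
Definition decay_time (M omega : R) lam : R := 2 * M / (re lam - omega).

Lemma rescaled_semigroup_decaying T lam (M omega : R) :
  1 <= M -> omega < re lam -> strongly_continuous_semigroup T ->
  (forall t, 0 <= t -> operator_norm_le (T t) (M * expR (omega * t))) ->
  decaying_semigroup M (decay_time M omega lam) (rescaled_semigroup T lam).
Proof.
move=> M1 lam_gt hT Tbound.
have lin t (t0 : 0 <= t) := semigroup_linear hT t0.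
have bound t x : 0 <= t ->
    `|rescaled_semigroup T lam t x| <= M * expR ((omega - re lam) * t) * `|x|.
  move=> t0; rewrite -(ler_of_real k) rmorphM /=.
  rewrite [leLHS]of_real_realify_norm [X in _ * X]of_real_realify_norm.
  rewrite normrZ normr_scalar_exp reN.
  have e0 : 0 <= of_real k (expR (- re lam * t)).
    by rewrite -(rmorph0 (of_real k)) ler_of_real expR_ge0.
  apply: le_trans (ler_wpM2l e0 (Tbound t t0 x)) _.
  rewrite mulrA -rmorphM /= (_ : _ * (M * _) = M * expR ((omega - re lam) * t))//.
  by rewrite mulrCA -expRD -mulrDl [- _ + _]addrC.
split.
- move=> t t0 a x y; rewrite /rescaled_semigroup.
  have := lin t t0 (of_real k a) x y => ->.
  by rewrite scalerDr scalerA mulrC -scalerA.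
- by move=> x; rewrite /rescaled_semigroup scalar_exp0 scale1r (semigroup0 hT).
- move=> s t x s0 t0; rewrite /rescaled_semigroup (semigroupD hT)// scalar_expD.
  have Z a y : T s (a *: y) = a *: T s y.
    have T0 : T s 0 = 0.
      by have := lin s s0 (-1) 0 0; rewrite scaleN1r addNr scaleN1r addNr.
    by have := lin s s0 a y 0; rewrite T0 !addr0.
  by rewrite Z scalerA.
- move=> t x t0; apply: le_trans (bound t x t0) _.
  rewrite ler_wpM2r// ler_piMr//; first lra.
  by rewrite -expR0 ler_expR nmulr_rle0// subr_lt0.
- move=> x; have tau0 : 0 <= decay_time M omega lam.
    by rewrite /decay_time divr_ge0//; lra.
  apply: le_trans (bound _ x tau0) _; rewrite ler_wpM2r//.
  have -> : (omega - re lam) * decay_time M omega lam = - (2 * M).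
    by rewrite /decay_time; field; rewrite subr_eq0 gt_eqF.
  rewrite expRN ler_pdivrMr ?expR_gt0//.
  have := expR_ge1Dx (2 * M); lra.
- move=> x; apply/subspace_continuousP => t tI.
  apply: (@cvgZ _ X).
    by apply: cvg_within_filter; exact: continuous_scalar_exp.
  by have /subspace_continuousP := @semigroup_orbit _ _ _ _ hT x; exact.
Qed.

(** The product rule at time 0 for the scalar exponential times the orbit. *)
Lemma quotient_rescale T (mu : scalars R k) (x y : X) :
  of_real k h^-1 *: (T h x - x) @[h --> 0^'+] --> y ->
  of_real k h^-1 *: (scalar_exp mu h *: T h x - x) @[h --> 0^'+] --> y + mu *: x.
Proof.
move=> Txy.
have e1 : scalar_exp mu h @[h --> 0^'+] --> (1 : scalars R k).
  rewrite -(scalar_exp0 mu); apply: cvg_within_filter.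
  exact: continuous_scalar_exp.
have -> : (fun h => of_real k h^-1 *: (scalar_exp mu h *: T h x - x)) = (fun h =>
    scalar_exp mu h *: (of_real k h^-1 *: (T h x - x)) +
    (of_real k h^-1 * (scalar_exp mu h - 1)) *: x).
  apply/funext => h; rewrite scalerA mulrC -!scalerA -scalerDr.
  by rewrite scalerBl scale1r (scalerBr (scalar_exp mu h)) subrKA.
rewrite -[y]scale1r.
exact: cvgD (cvgZ e1 Txy)
  (cvgZ (scalar_exp_right_derivative (mu := mu)) (cvg_cst x)).
Qed.

Lemma generator_rescaled T (A : linear_operator X X) lam (y x : X) :
  is_generator T A ->
  generator_graph (V := realify X) (rescaled_semigroup T lam) y (- x) <->
  dom A y /\ lam *: y - A y = x.
Proof.
move=> [domA cvgA]; split => [H|[Ay <-]]; last first.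
  rewrite opprB.
  have := quotient_rescale (mu := - lam) (cvgA y Ay).
  by rewrite scaleNr.
(* Rescaling back by [lam] recovers [T], whose quotients at [y] therefore converge; this puts [y] in
   the domain of [A]. *)
have := @quotient_rescale (rescaled_semigroup T lam) lam y (- x) H.
have -> : (fun h => of_real k h^-1 *:
    (scalar_exp lam h *: (rescaled_semigroup T lam h y : X) - y)) =
    (fun h => of_real k h^-1 *: (T h y - y)).
  by apply/funext => h; rewrite /rescaled_semigroup scalerA scalar_expVK scale1r.
move=> cTy.
have Ay : dom A y by apply/domA; apply/cvg_ex; eexists; exact: cTy.
split => //.
have -> : A y = - x + lam *: y.
  exact: (cvg_unique (@norm_hausdorff _ X) (cvgA y Ay) cTy).
by rewrite opprD opprK addrCA subrr addr0.
Qed.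

(** Surjectivity of the rescaled generator provides a solution of [lam *: y - A y = x], so [xget]
    returns a genuine solution and not its default 0. *)
Lemma resolvent_inverse_generator T (A : linear_operator X X) lam (M tau : R) :
  0 < M -> 0 < tau -> is_generator T A ->
  decaying_semigroup M tau (rescaled_semigroup T lam) ->
  is_inverse_generator (rescaled_semigroup T lam) (resolvent A lam).
Proof.
move=> M0 tau0 hA hU x.
have [y Hy] := inverse_generator_exists M0 tau0 hU x.
have Ay := (generator_rescaled lam y x hA).1 Hy.
pose P := [set z | dom A z /\ lam *: z - A z = x].
have PA : P (resolvent A lam x) by apply: xgetPex; exists y.
refine ((generator_rescaled lam (resolvent A lam x) x hA).2 PA).
Qed.

End Rescaling.

Theorem theorem3p1 (R : realType) (k : scalar_kind)
  (X Y : completeNormedModType (scalars R k))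
  (le : Y -> Y -> Prop) (hle : vector_order le)
  (hcone : closed (positive_cone le))
  (S : linear_operator X Y) (hS : closed_operator S)
  (T : R -> X -> X) (A : linear_operator X X)
  (hT : strongly_continuous_semigroup T) (hA : is_generator T A)
  (Tn : nat -> R -> X -> X) (An : nat -> linear_operator X X)
  (hTn : forall n, strongly_continuous_semigroup (Tn n))
  (hAn : forall n, is_generator (Tn n) (An n))
  (hshape : forall n, shape_preserving le S (An n) (Tn n))
  (M omega : R) (hM : 1 <= M)
  (hTbound : forall t, 0 <= t ->
     operator_norm_le (T t) (M * expR (omega * t)))
  (hTnbound : forall n t, 0 <= t ->
     operator_norm_le (Tn n t) (M * expR (omega * t)))
  (lam : scalars R k) (hlam : omega < re lam)
  (hres : forall x, resolvent (An n) lam x @[n --> \oo] --> resolvent A lam x)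
  (hcompat : compatible le S A) :
  shape_preserving le S A T.
Proof.
have M0 : 0 < M by lra.
have tau0 : 0 < decay_time M omega lam.
  by rewrite divr_gt0// ?subr_gt0// mulr_gt0.
have hU := rescaled_semigroup_decaying hM hlam hT hTbound.
have hUn n := rescaled_semigroup_decaying hM hlam (hTn n) (@hTnbound n).
split=> [|t t0 _ [x Cx <-]]; first exact/esym.
have hF : is_inverse_generator (rescaled_semigroup T lam) (resolvent A lam).
  exact: resolvent_inverse_generator hA hU.
have hFn n :
    is_inverse_generator (rescaled_semigroup (Tn n) lam) (resolvent (An n) lam).
  exact: resolvent_inverse_generator (hAn n) (hUn n).
have Un_cvg : scalar_exp (- lam) t *: Tn n t x @[n --> \oo] -->
    scalar_exp (- lam) t *: T t x.
  have := @Trotter_Kato _ (realify X) _ _ _ _ _ _ t x M0 tau0 hU hUn hF hFn hres t0.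
  exact.
have Tn_cvg : Tn n t x @[n --> \oo] --> T t x.
  have E z : z = scalar_exp lam t *: (scalar_exp (- lam) t *: z).
    by rewrite scalerA scalar_expVK scale1r.
  rewrite [T t x]E (_ : (fun n => Tn n t x) = (fun n =>
    scalar_exp lam t *: (scalar_exp (- lam) t *: Tn n t x))).
    exact: cvgZ (cvg_cst _) Un_cvg.
  by apply/funext => n.
(* Every [Tn n t x] lies in the cone, which is closed as a closure and so contains the limit
   [T t x]. *)
apply: (@closed_cvg _ _ _ _ _ (shape_cone le S) (@closed_closure _ _) _ _ Tn_cvg).
by apply: nearW => n; have [_ TnC] := hshape n; apply: (TnC t t0); exists x.
Qed.
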